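(* Let $n,K\ge 1$ be integers, $\delta\ge 0$, and for each $j\in[n]$ let $a_j\in\mathbb{R}$, $b_j>0$, $0\le l_j<u_j$, $\Delta_j=(u_j-l_j)/K$, $f_j(x)=xe^{(a_j-x)/b_j}$, $g_j(x)=e^{(a_j-x)/b_j}$, and for $k=0,\ldots,K-1$ let $$\gamma^f_{jk}=\frac{f_j((k+1)\Delta_j)-f_j(k\Delta_j)}{\Delta_j},\qquad \gamma^g_{jk}=\frac{g_j((k+1)\Delta_j)-g_j(k\Delta_j)}{\Delta_j}.$$ Let $\mathbf B$ be a real matrix with $n$ columns and $\mathbf d$ a real vector of matching length. Consider the mixed-integer program (MILP) $$\max_{\mathbf w,\mathbf z,\mathbf r}\ \sum_{j\in[n]}\bigl(f_j(l_j)-\delta g_j(l_j)\bigr)+\sum_{j\in[n]}\sum_{k=0}^{K-1}\Delta_j(\gamma^f_{jk}-\delta\gamma^g_{jk})w_{jk}-\delta$$ subject to (1) $z_{jk}\ge z_{j,k+1}$ for $k=0,\ldots,K-2$, $j\in[n]$; (2) $z_{jk}\le w_{jk}\le 1$ for $k=0,\ldots,K-1$, $j\in[n]$; (3) $w_{j,k+1}\le z_{jk}$ for $k=0,\ldots,K-2$, $j\in[n]$; (4) $r_j=\Delta_j\sum_{k=0}^{K-1}w_{jk}$ for $j\in[n]$; (5) $\mathbf B\mathbf r\le\mathbf d$; (6) $z_{jk}\in\{0,1\}$ and $w_{jk}\in\mathbb{R}$ for $k=0,\ldots,K-1$, $j\in[n]$. Let (Re-MILP) be the program with the same objective and constraints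 (1)-(5), $w_{jk}\in[0,1]$ for all $j,k$, and with (6) replaced by: $z_{jk}\in[0,1]$ for $0\le k\le\lfloor 2b_j/\Delta_j\rfloor-1$ and $z_{jk}\in\{0,1\}$ for $k\ge\lfloor 2b_j/\Delta_j\rfloor$ (with $k\in\{0,\ldots,K-1\}$ throughout). Then (MILP) and (Re-MILP) are equivalent. As a result, if $u_j\le 2b_j$ for all $j\in[n]$, then (MILP) is equivalent to the linear program (LP) with the same objective, constraints (1)-(5), and $z_{jk}\in[0,1]$, $w_{jk}\in[0,1]$ for all $j\in[n]$, $k\in\{0,\ldots,K-1\}$.
   Context: $[n]=\{1,\ldots,n\}$. Two of these programs are called equivalent if one is feasible if and only if the other is, they have the same optimal value, and a vector $\mathbf r$ is the $\mathbf r$-part of an optimal solution of one if and only if it is the $\mathbf r$-part of an optimal solution of the other. *)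

(* Defs.v *)
From mathcomp Require Import all_boot all_order all_algebra.
From mathcomp Require Import all_classical all_reals all_analysis.

Set Implicit Arguments.
Unset Strict Implicit.
Unset Printing Implicit Defensive.

Import Order.TTheory GRing.Theory Num.Theory.
Local Open Scope classical_set_scope.
Local Open Scope ring_scope.

Record variables (R : realType) (n K : nat) := Wzr {
  wpart : 'M[R]_(n, K);
  zpart : 'M[R]_(n, K);
  rpart : 'cV[R]_n }.

(* Programs are maximization programs. *)
Record program (R : realType) (n K : nat) := Program {
  feasible : set (variables R n K);
  objective : variables R n K -> R }.

Definition optimal (R : realType) (n K : nat) (P : program R n K)
    (x : variables R n K) : Prop :=
  feasible P x /\ forall y, feasible P y -> objective P y <= objective P x.

(* Extended-real valued: it is -oo for an infeasible program and +oo for an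
   unbounded one. *)
Definition optimal_value (R : realType) (n K : nat) (P : program R n K) :
    \bar R :=
  ereal_sup [set (objective P x)%:E | x in feasible P].

Definition optimal_rpart (R : realType) (n K : nat) (P : program R n K) :
    set 'cV[R]_n :=
  [set r | exists2 x, optimal P x & rpart x = r].

Definition equivalent (R : realType) (n K : nat) (P Q : program R n K) :
    Prop :=
  [/\ feasible P !=set0 <-> feasible Q !=set0,
      optimal_value P = optimal_value Q &
      forall r, optimal_rpart P r <-> optimal_rpart Q r].

Section Programs.

Context (R : realType) (n K m : nat) (delta : R) (a b l u : 'I_n -> R).
Context (B : 'M[R]_(m, n)) (d : 'cV[R]_m).

Definition f (j : 'I_n) (x : R) : R := x * expR ((a j - x) / b j).

Definition g (j : 'I_n) (x : R) : R := expR ((a j - x) / b j).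

Definition Delta (j : 'I_n) : R := (u j - l j) / K%:R.

Definition slope (h : 'I_n -> R -> R) (j : 'I_n) (k : nat) : R :=
  (h j (k.+1%:R * Delta j) - h j (k%:R * Delta j)) / Delta j.

Definition obj (x : variables R n K) : R :=
  (\sum_(j < n) (f j (l j) - delta * g j (l j)))
  + (\sum_(j < n) \sum_(k < K)
       Delta j * (slope f j k - delta * slope g j k) * wpart x j k)
  - delta.

(* The constraints shared by all the programs; the successor of an index k is
   an index k' with k' = k + 1, so k ranges over 0, ..., K - 2 in the first and
   third ones. *)
Definition linear_constraints (x : variables R n K) : Prop :=
  [/\ forall (j : 'I_n) (k k' : 'I_K), k' = k.+1 :> nat ->
        zpart x j k >= zpart x j k',
      forall (j : 'I_n) (k : 'I_K), zpart x j k <= wpart x j k <= 1,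
      forall (j : 'I_n) (k k' : 'I_K), k' = k.+1 :> nat ->
        wpart x j k' <= zpart x j k,
      forall j : 'I_n, rpart x j 0 = Delta j * \sum_(k < K) wpart x j k &
      forall i : 'I_m, (B *m rpart x) i 0 <= d i 0].

Definition is_binary (t : R) : Prop := t = 0 \/ t = 1.

Definition MILP : program R n K := Program
  [set x | linear_constraints x /\
     forall (j : 'I_n) (k : 'I_K), is_binary (zpart x j k)]
  obj.

Definition ReMILP : program R n K := Program
  [set x | [/\ linear_constraints x,
     forall (j : 'I_n) (k : 'I_K), 0 <= wpart x j k <= 1,
     forall (j : 'I_n) (k : 'I_K),
       k%:Z <= Num.floor (2 * b j / Delta j) - 1 -> 0 <= zpart x j k <= 1 &
     forall (j : 'I_n) (k : 'I_K),
       k%:Z >= Num.floor (2 * b j / Delta j) -> is_binary (zpart x j k)]]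
  obj.

Definition LP : program R n K := Program
  [set x | [/\ linear_constraints x,
     forall (j : 'I_n) (k : 'I_K), 0 <= zpart x j k <= 1 &
     forall (j : 'I_n) (k : 'I_K), 0 <= wpart x j k <= 1]]
  obj.

End Programs.

(* Main.v *)
Require Import Defs.
From mathcomp Require Import all_boot all_order all_algebra.
From mathcomp Require Import all_classical all_reals all_analysis.
From mathcomp Require Import ring lra.
Import Order.TTheory GRing.Theory Num.Theory.
Local Open Scope ring_scope.

(** The equivalence of MILP and Re-MILP follows from one domination property
    (equivalent_of_domination): every point of the relaxation can be replaced
    by a point of MILP with the same r-part and at least the same objective.

    Fix j and write t for the sum of the weights w_jk over k.  With binary z,
    the constraints say exactly that w fills the K segments greedily, from left
    to right: w_jk is t - k truncated to [0, 1].  The r-part only depends on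
    the numbers t, so the replacement keeps t and refills greedily.  It moves
    weight from segments k to segments i with i < k, and only when w_i <> 1 and
    w_k <> 0 (sum_le_greedy_fill).  Hence it cannot decrease the objective if
    the gain of a segment i is at least that of a segment k > i in all these
    cases.

    For kDelta_j <= 2b_j this holds since the gains are nonincreasing up to the
    first segment ending beyond 2b_j (gain_le).  The function f_j is concave
    only up to its inflection point 2b_j, so concavity says nothing about the
    segment that contains this point; but f_j lies above the chord of
    [x - D, x + D] at the midpoint x for every x <= 2b_j, however large D
    is (f_midpoint).  This reduces to the inequality tanh y <= y.  Since g_j is
    convex and delta >= 0, the term in g_j goes the same way.

    For kDelta_j > 2b_j the variable z_(k-1) is binary, and either value
    forces the weights to be greedy around k: if it is 0 then w_k = 0, and if
    it is 1 then w_i = 1 for all i < k (ReMILP_exchange).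

    Finally u_j <= 2b_j implies KDelta_j <= 2b_j, so Re-MILP has no binary
    variable left and is the linear program. *)

(** * Replacing a program by a dominated relaxation *)

Lemma equivalent_of_domination {R : realType} {n K : nat} (P Q : program R n K) :
  objective P = objective Q ->
  (forall x, feasible P x -> feasible Q x) ->
  (forall x, feasible Q x -> exists y,
     [/\ feasible P y, rpart y = rpart x & objective Q x <= objective Q y]) ->
  equivalent P Q.
Proof.
case: P Q => FP oP [FQ oQ] /= -> PQ QP; split => /=.
- split=> [[x xP]|[x /QP[y [yP _ _]]]]; first by exists x; exact: PQ.
  by exists y.
- apply/eqP; rewrite eq_le; apply/andP; split.
    by apply: ereal_sup_le => _ [x xP <-]; exists x => //; exact: PQ.
  apply: ge_ereal_sup => _ [x /QP[y [yP _ xy]] <-].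
  apply: (@le_trans _ _ (oQ y)%:E); first by rewrite lee_fin.
  by apply: ereal_sup_ubound; exists y.
- move=> r; split=> -[x [/= xF xmax] <-].
    exists x => //; split=> [|y /QP[y' [y'P _ /le_trans]]] /=; first exact: PQ.
    by apply; exact: xmax.
  have [y [yP <- xy]] := QP x xF.
  exists y => //; split=> //= y' /PQ /xmax y'x.
  exact: le_trans xy.
Qed.

(** * Greedy fillings *)

Lemma sum_unit_itv {R : realType} {K : nat} (w : 'I_K -> R) :
  (forall k, 0 <= w k <= 1) -> 0 <= \sum_k w k <= K%:R.
Proof.
move=> w01.
rewrite sumr_ge0 => [|k _]; last by case/andP: (w01 k).
rewrite -[X in X%:R]card_ord -sum1_card natr_sum ler_sum// => k _.
by case/andP: (w01 k).
Qed.

(** When [0 <= t <= K], this distributes a total weight [t] over [K] segments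
    of capacity 1, from left to right. *)
Definition greedy_fill {R : realType} (t : R) (k : nat) : R :=
  Num.max 0 (Num.min 1 (t - k%:R)).

Lemma greedy_fill_itv {R : realType} (t : R) k : 0 <= greedy_fill t k <= 1.
Proof. by rewrite /greedy_fill le_max lexx ge_max ler01 ge_min lexx. Qed.

Lemma greedy_fill1 {R : realType} (t : R) k : k.+1%:R <= t -> greedy_fill t k = 1.
Proof.
rewrite -natr1 /greedy_fill => tk.
by rewrite min_l ?max_r ?ler01 //; lra.
Qed.

Lemma greedy_fill0 {R : realType} (t : R) k : t <= k%:R -> greedy_fill t k = 0.
Proof.
by move=> tk; rewrite /greedy_fill max_l// ge_min subr_le0 tk orbT.
Qed.

Lemma sum_greedy_fill {R : realType} (t : R) K :
  0 <= t <= K%:R -> \sum_(k < K) greedy_fill t k = t.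
Proof.
case/andP=> t0.
have -> : \sum_(k < K) greedy_fill t k = Num.min t K%:R.
  elim: K => [|K IH]; first by rewrite big_ord0 min_r.
  rewrite big_ord_recr/= IH /greedy_fill -natr1.
  have K0 : 0 <= K%:R :> R by exact: ler0n.
  case: (leP t K%:R) => ?; case: (leP 1 (t - K%:R)) => ?;
    by case: (leP t (K%:R + 1)) => ?; case: leP => ?; lra.
by move=> tK; rewrite min_l.
Qed.

(** Transferring weight towards larger coefficients increases a weighted sum:
    all the coefficients can be compared with the least one that gains weight,
    since subtracting a constant from [c] does not change the sum. *)
Lemma sum_transfer_ge0 {R : realType} {I : finType} (c d : I -> R) :
  \sum_i d i = 0 ->
  (forall i k, 0 < d i -> d k < 0 -> c k <= c i) ->
  0 <= \sum_i c i * d i.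
Proof.
move=> d0 cd.
suff [s scd] : exists s, forall i, 0 <= (c i - s) * d i.
  have -> : \sum_i c i * d i = \sum_i (c i - s) * d i.
    rewrite -[LHS]subr0 -[X in _ - X](mulr0 s) -[X in _ - s * X]d0 mulr_sumr.
    by rewrite -sumrB; apply: eq_bigr => i _; rewrite mulrBl.
  by apply: sumr_ge0 => i _; exact: scd.
have [/existsP[i0 di0]|/existsPn d_le0] := boolP [exists i, 0 < d i].
  case: (@arg_minP _ _ _ i0 (fun i => 0 < d i) c di0) => i di imin; exists (c i) => k.
  case: (ltgtP (d k) 0) => dk; last by rewrite dk mulr0.
    by rewrite mulr_le0 ?(ltW dk)// subr_le0 cd.
  by rewrite mulr_ge0 ?(ltW dk)// subr_ge0 imin.
(* No index gains weight: any upper bound of c will do. *)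
exists (\sum_i `|c i|) => k; rewrite mulr_le0 //; last by rewrite leNgt d_le0.
rewrite subr_le0 (le_trans (ler_norm _))// (bigD1 k)//= lerDl.
exact: sumr_ge0.
Qed.

(** If the greedy filling gains weight at [i] and loses weight at [k], then
    [i < k], and [w] is neither full at [i] nor empty at [k]. *)
Lemma sum_le_greedy_fill {R : realType} {K : nat} (c w : 'I_K -> R) :
  (forall k, 0 <= w k <= 1) ->
  (forall i k : 'I_K, (i < k)%N -> w i <> 1 -> w k <> 0 -> c k <= c i) ->
  \sum_k c k * w k <= \sum_k c k * greedy_fill (\sum_k w k) k.
Proof.
move=> w01 cw; rewrite -subr_ge0 -sumrB.
set t := \sum_k w k.
have t_itv : 0 <= t <= K%:R by exact: sum_unit_itv.
under eq_bigr do rewrite -mulrBr.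
apply: sum_transfer_ge0 => [|i k].
  by rewrite sumrB sum_greedy_fill// subrr.
rewrite subr_gt0 subr_lt0 => wi wk.
have /andP[wi0 _] := w01 i; have /andP[_ wk1] := w01 k.
have /andP[gk0 _] := greedy_fill_itv t k.
have /andP[_ gi1] := greedy_fill_itv t i.
have ti : i%:R < t.
  by rewrite ltNge; apply/negP => /greedy_fill0 gi; lra.
have tk : t < k.+1%:R.
  by rewrite ltNge; apply/negP => /greedy_fill1 gk; lra.
have : (i <= k)%N by rewrite -ltnS -(ltr_nat R) (lt_trans ti).
rewrite leq_eqVlt => /orP[/eqP/val_inj ik|ik]; first by move: wi wk; rewrite ik; lra.
by apply: cw => // [wi1|wk0]; lra.
Qed.

(** * The gains of consecutive segments *)

(** This is [tanh y <= y] for [s = 2 * y], multiplied out. *)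
Lemma expR_trapezoid {R : realType} (s : R) :
  0 <= s -> 2 * (expR s - 1) <= s * (expR s + 1).
Proof.
move=> s0.
pose h (x : R) := (x - 2) * expR x + (x + 2).
have dh (x : R) : is_derive x 1 h ((x - 1) * expR x + 1).
  apply: is_derive_eq; rewrite /GRing.scale/=.
  by ring.
have h_ge0 : h 0 <= h s.
  apply: (@ger0_derive1_ndecry _ h 0) => // [x _|].
    rewrite derive1E derive_val.
    (* (x - 1) * exp x + 1 >= 0 amounts to exp (- x) >= 1 - x. *)
    have := expR_ge1Dx (- x); have := expR_gt0 x; have := expRxMexpNx_1 x.
    by nra.
  apply: derivable_within_continuous => y _.
  exact: ex_derive.
by move: h_ge0; rewrite /h expR0; lra.
Qed.

Section Gains.

Context {R : realType} {n : nat} (a b : 'I_n -> R) (j : 'I_n).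
Hypothesis b_gt0 : 0 < b j.

Lemma shift_left (x D : R) :
  (a j - (x - D)) / b j = (a j - x) / b j + D / b j.
Proof. by rewrite -mulrDl opprB addrA addrAC. Qed.

Lemma shift_right (x D : R) :
  (a j - (x + D)) / b j = (a j - x) / b j - D / b j.
Proof. by rewrite -mulrBl opprD addrA. Qed.

(** Up to a nonnegative factor, the difference of the two sides is
    [D * (E + 1) - x * (E - 1)] with [E = expR (D / b j)]; the worst case
    [x = 2 * b j] is the trapezoid inequality. *)
Lemma f_midpoint (x D : R) : 0 <= D -> x <= 2 * b j ->
  f a b j (x - D) + f a b j (x + D) <= 2 * f a b j x.
Proof.
move=> D0 xb; rewrite /f shift_left shift_right.
set s := D / b j.
have s0 : 0 <= s by rewrite divr_ge0// ltW.
have DE : D = s * b j by rewrite /s divfK// gt_eqF.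
rewrite !expRD.
set G := expR _; set E := expR s; set F := expR (- s).
have G0 : 0 < G := expR_gt0 _.
have F0 : 0 < F := expR_gt0 _.
have EF : E * F = 1 := expRxMexpNx_1 s.
have E1 : 1 <= E by rewrite /E -expR0 ler_expR.
have key : x * (E - 1) <= D * (E + 1).
  apply: (@le_trans _ _ (2 * b j * (E - 1))); first by rewrite ler_wpM2r// subr_ge0.
  by have := ler_wpM2l (ltW b_gt0) (expR_trapezoid _ s0); rewrite -/E DE; lra.
rewrite -subr_ge0.
have -> : 2 * (x * G) - ((x - D) * (G * E) + (x + D) * (G * F))
        = G * F * (E - 1) * (D * (E + 1) - x * (E - 1)).
  transitivity (2 * (x * G) * (E * F)
      - ((x - D) * (G * E * (E * F)) + (x + D) * (G * F))); last by ring.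
  by rewrite EF; ring.
by rewrite !mulr_ge0 ?subr_ge0 ?(ltW G0) ?(ltW F0).
Qed.

(** Convexity of the exponential. *)
Lemma g_midpoint (x D : R) :
  2 * g a b j x <= g a b j (x - D) + g a b j (x + D).
Proof.
rewrite /g shift_left shift_right.
rewrite !expRD.
set G := expR _; set E := expR (D / b j); set F := expR (- _).
have G0 : 0 < G := expR_gt0 _.
have F0 : 0 < F := expR_gt0 _.
have EF : E * F = 1 := expRxMexpNx_1 _.
rewrite -subr_ge0.
have -> : G * E + G * F - 2 * G = G * F * (E - 1) ^+ 2.
  transitivity (G * E * (E * F) + G * F - 2 * G * (E * F)); last by ring.
  by rewrite EF; ring.
by rewrite mulr_ge0 ?sqr_ge0// mulr_ge0// ltW.
Qed.

Context (K : nat) (delta : R) (l u : 'I_n -> R).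
Hypothesis delta_ge0 : 0 <= delta.
Hypothesis Delta_gt0 : 0 < Delta K l u j.

(** The coefficient of [w_jk] in the objective. *)
Definition gain (k : nat) : R :=
  Delta K l u j * (slope K l u (f a b) j k - delta * slope K l u (g a b) j k).

(** Segments [k] and [k.+1] meet at [x = k.+1%:R * Delta], so this is the
    midpoint inequality for [f - delta * g] at [x]; the right end of segment
    [k.+1] may well exceed [2 * b j]. *)
Lemma gain_succ (k : nat) :
  k.+1%:R * Delta K l u j <= 2 * b j -> gain k.+1 <= gain k.
Proof.
move=> kb; rewrite /gain ler_pM2l// /slope.
have D0 := Delta_gt0; set D := Delta K l u j in D0 kb *.
have := f_midpoint _ _ (ltW D0) kb.
have := ler_wpM2l delta_ge0 (g_midpoint (k.+1%:R * D) D).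
have -> : k.+1%:R * D - D = k%:R * D by rewrite -natr1; ring.
have -> : k.+1%:R * D + D = k.+2%:R * D by rewrite -[k.+2%:R]natr1; ring.
move=> Hg Hf.
rewrite !(mulrA delta) -!mulrBl ler_pM2r ?invr_gt0//.
lra.
Qed.

Lemma gain_le (i k : nat) :
  (i <= k)%N -> k%:R * Delta K l u j <= 2 * b j -> gain k <= gain i.
Proof.
elim: k => [|k IH]; first by rewrite leqn0 => /eqP->.
rewrite leq_eqVlt => /orP[/eqP->//|ik kb].
rewrite (le_trans (gain_succ k kb))// IH// (le_trans _ kb)//.
by rewrite ler_pM2r// ler_nat.
Qed.

End Gains.

(** * The relaxation *)

Section Relaxation.

Context {R : realType} {n K m : nat} (delta : R) (a b l u : 'I_n -> R).
Context (B : 'M[R]_(m, n)) (d : 'cV[R]_m).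
Hypothesis delta_ge0 : 0 <= delta.
Hypothesis b_gt0 : forall j, 0 < b j.
Hypothesis Delta_gt0 : forall j, 0 < Delta K l u j.

Lemma zpart_nonincreasing (x : variables R n K) j (i k : 'I_K) :
  linear_constraints l u B d x -> (i <= k)%N -> zpart x j k <= zpart x j i.
Proof.
case=> z_succ _ _ _ _.
case: k => k kK /=; elim: k kK => [|k IH] kK.
  by rewrite leqn0 => /eqP i0; rewrite le_eqVlt (_ : Ordinal kK = i) ?eqxx//; apply: val_inj.
rewrite leq_eqVlt => /orP[/eqP ik|ik].
  by rewrite le_eqVlt (_ : Ordinal kK = i) ?eqxx//; apply: val_inj.
by rewrite (le_trans (z_succ j (Ordinal (ltnW kK)) (Ordinal kK) erefl))// IH.
Qed.

(** For [k * Delta <= 2 * b j] the gains are ordered.  Beyond that they need not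
    be, but [z_(k-1)] is binary there: [z_(k-1) = 0] empties segment [k] since
    [w_k <= z_(k-1)], and [z_(k-1) = 1] fills every earlier segment [i] since
    [z_(k-1) <= z_i <= w_i]. *)
Lemma ReMILP_exchange (x : variables R n K) j (i k : 'I_K) :
  feasible (ReMILP K delta a b l u B d) x ->
  (i < k)%N -> wpart x j i <> 1 -> wpart x j k <> 0 ->
  gain a b j K delta l u k <= gain a b j K delta l u i.
Proof.
move=> [lin w01 _ zbin] ik wi wk.
have [kb|kb] := leP (k%:Z : int) (Num.floor (2 * b j / Delta K l u j)).
  apply: gain_le => //; first exact: ltnW.
  rewrite -ler_pdivlMr//.
  have := floor_le (2 * b j / Delta K l u j).
  by apply: le_trans; rewrite pmulrn ler_int.
have k'K : (k.-1 < K)%N by rewrite (leq_ltn_trans (leq_pred k)).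
pose k' := Ordinal k'K.
have kk' : k = k'.+1 :> nat by rewrite /= prednK// (leq_ltn_trans _ ik).
have [_ zw wz _ _] := lin.
have /zbin zk' : k'%:Z >= Num.floor (2 * b j / Delta K l u j) :> int.
  by move: kb; rewrite kk' -[k'.+1]addn1 PoszD ltzD1.
case: zk' => zk'.
  case: wk; apply/eqP; rewrite eq_le -{1}zk' wz//.
  by case/andP: (w01 j k).
case: wi; apply/eqP; rewrite eq_le.
have /andP[zwi ->] := zw j i.
rewrite (le_trans _ zwi)// -zk'; apply: zpart_nonincreasing lin _.
by rewrite -ltnS -kk'.
Qed.

(** The greedy filling with the same totals; a binary [z] marks the segments
    filled to capacity. *)
Definition greedy (x : variables R n K) : variables R n K :=
  let t j := \sum_(k < K) wpart x j k in
  Wzr (\matrix_(j, k) greedy_fill (t j) k)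
      (\matrix_(j, k) (k.+1%:R <= t j)%R%:R)
      (rpart x).

Lemma greedy_feasible (x : variables R n K) :
  feasible (ReMILP K delta a b l u B d) x ->
  feasible (MILP K delta a b l u B d) (greedy x).
Proof.
move=> [[_ _ _ rE rB] w01 _ _]; split; last first.
  by move=> j k; rewrite mxE; case: (_ <= _); [right|left].
have t_itv j : 0 <= \sum_(k < K) wpart x j k <= K%:R by exact: sum_unit_itv.
split=> //.
- move=> j k k' kk'; rewrite !mxE kk' ler_nat.
  case: (leP k.+2%:R) => // kt.
  by rewrite (le_trans _ kt)// ler_nat.
- move=> j k; rewrite !mxE.
  have /andP[g0 ->] := greedy_fill_itv (\sum_(k < K) wpart x j k) k.
  by rewrite andbT; case: (leP k.+1%:R) => // /greedy_fill1->.
- move=> j k k' kk'; rewrite !mxE kk'.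
  case: (leP k.+1%:R) => [_|/ltW/greedy_fill0->//].
  by case/andP: (greedy_fill_itv (\sum_(k < K) wpart x j k) k.+1).
- move=> j; rewrite rE; congr (_ * _).
  by under [RHS]eq_bigr do rewrite mxE; rewrite sum_greedy_fill.
Qed.

Lemma obj_le_greedy (x : variables R n K) :
  feasible (ReMILP K delta a b l u B d) x ->
  obj delta a b l u x <= obj delta a b l u (greedy x).
Proof.
move=> xF; rewrite /obj lerD2r lerD2l; apply: ler_sum => j _.
under [leRHS]eq_bigr do rewrite mxE.
apply: (@sum_le_greedy_fill _ _ (fun k => gain a b j K delta l u k)).
  by case: xF.
by move=> i k; exact: ReMILP_exchange xF.
Qed.

Lemma MILP_equivalent_ReMILP :
  equivalent (MILP K delta a b l u B d) (ReMILP K delta a b l u B d).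
Proof.
apply: equivalent_of_domination => // x; last first.
  move=> xF; exists (greedy x); split=> //.
    exact: greedy_feasible.
  exact: obj_le_greedy.
case=> lin zbin; have [_ zw _ _ _] := lin.
have z01 j k : 0 <= zpart x j k <= 1.
  by case: (zbin j k) => ->; rewrite lexx ler01.
split=> // j k; have /andP[zwk ->] := zw j k.
by rewrite (le_trans _ zwk)//; case/andP: (z01 j k).
Qed.

Lemma ReMILP_eq_LP : (forall j, K%:R * Delta K l u j <= 2 * b j) ->
  ReMILP K delta a b l u B d = LP K delta a b l u B d.
Proof.
move=> ub; congr Program; apply/predeqP => x.
have all_relaxed j (k : 'I_K) : k%:Z < Num.floor (2 * b j / Delta K l u j) :> int.
  apply: (@lt_le_trans _ _ K%:Z); first by rewrite ltz_nat.
  by rewrite floor_ge_int -pmulrn ler_pdivlMr.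
split=> -[lin].
  move=> w01 z01 _; split=> // j k; apply: z01.
  by rewrite lerBrDr lezD1.
move=> z01 w01; split=> // j k.
by rewrite leNgt all_relaxed.
Qed.

End Relaxation.

Theorem theorem1 (R : realType) (n K m : nat) (delta : R)
    (a b l u : 'I_n -> R) (B : 'M[R]_(m, n)) (d : 'cV[R]_m)
    (n_gt0 : (0 < n)%N) (K_gt0 : (0 < K)%N) (delta_ge0 : 0 <= delta)
    (b_gt0 : forall j, 0 < b j)
    (l_ge0 : forall j, 0 <= l j) (l_lt_u : forall j, l j < u j) :
  equivalent (MILP K delta a b l u B d) (ReMILP K delta a b l u B d)
  /\ ((forall j, u j <= 2 * b j) ->
      equivalent (MILP K delta a b l u B d) (LP K delta a b l u B d)).
Proof.
have K0 : 0 < K%:R :> R by rewrite ltr0n.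
have Delta_gt0 j : 0 < Delta K l u j by rewrite divr_gt0// subr_gt0.
have MR := MILP_equivalent_ReMILP delta a b l u B d delta_ge0 b_gt0 Delta_gt0.
split=> // ub; rewrite -ReMILP_eq_LP// => j.
rewrite /Delta mulrCA divff ?gt_eqF// mulr1.
by have := ub j; have := l_ge0 j; lra.
Qed.
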